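(* Let $\triangle$ be a spherical $n$-simplex in $S^n$ with vertices $p_1,\dots,p_{n+1}$ and edge matrix $M$, let $0\le k\le n-1$, let $W=\mathrm{span}\{p_1,\dots,p_{k+1}\}\subset R^{n+1}$, and let $W^s=W\cap S^n$ be the $k$-plane containing the $k$-face of $\triangle$ with vertices $p_1,\dots,p_{k+1}$. Let $p$ be a point of $S^n$. Then $$ \cos\theta(p,W^s)=\sqrt{1-\sum_{s,t=k+2}^{n+1}\frac{\sqrt{M_{ss}M_{tt}}\; m_{t}^{s}\,\langle p,e_t\rangle_E\langle p,e_s\rangle_E}{|M|\,m^{k+1}}}, $$ where $\theta(p,W^s)$ is the distance between $p$ and $W^s$.
   Context: $R^{n+1}$ carries the Euclidean scalar product $\langle x,y\rangle_E=\sum_{i=1}^{n+1}x_iy_i$, and $S^n=\{x\in R^{n+1}:\langle x,x\rangle_E=1\}$ is the unit sphere with distance $\arccos\langle p,q\rangle_E$. A $k$-plane of $S^n$ is the intersection of $S^n$ with a $(k+1)$-dimensional linear subspace. A spherical $n$-simplex $\triangle$ has vertices $p_1,\dots,p_{n+1}\in S^n$ that are linearly independent in $R^{n+1}$. The edge matrix of $\triangle$ is $M=[\langle p_i,p_j\rangle_E]_{i,j=1,\dots,n+1}$; $|M|$ is its determinant and $M_{ij}$ is its $(i,j)$ cofactor (signed minor); so $M_{ii}$ is the determinant of $M$ with row and column $i$ deleted. The unit outer normal of the face opposite $p_i$ is $$e_i=\frac{-\sum_{j=1}^{n+1}M_{ij}p_j}{\sqrt{M_{ii}|M|}},\qquad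 i=1,\dots,n+1.$$ $m^{k+1}$ is the determinant of the submatrix of $M$ with rows and columns $1,\dots,k+1$. For $i,j\in\{k+2,\dots,n+1\}$, $m_i^j$ is the determinant of the submatrix of $M$ with rows $1,\dots,k+1,i$ and columns $1,\dots,k+1,j$. The distance between $p$ and the $k$-plane $W^s$ is the length of the geodesic segment from $p$ to its perpendicular foot on $W^s$, i.e. to the nearest point of $W^s$ (any nearest point if it is not unique); thus $\theta(p,W^s)=\min_{q\in W^s}\arccos\langle p,q\rangle_E\in[0,\pi/2]$. *)

(* Defs.v *)
From mathcomp Require Import all_boot all_order all_algebra.
From mathcomp Require Import all_classical all_reals all_analysis.
Set Implicit Arguments.
Unset Strict Implicit.
Unset Printing Implicit Defensive.
Import Order.TTheory GRing.Theory Num.Theory.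
Local Open Scope classical_set_scope.
Local Open Scope ring_scope.

Definition dotE (R : realType) (d : nat) (x y : 'rV[R]_d) : R :=
  \sum_(i < d) x 0 i * y 0 i.

Definition unit_sphere (R : realType) (d : nat) : set 'rV[R]_d :=
  [set x | dotE x x = 1].

Definition sphere_dist (R : realType) (d : nat) (x y : 'rV[R]_d) : R :=
  acos (dotE x y).

Definition dist_to (R : realType) (d : nat) (x : 'rV[R]_d)
    (A : set 'rV[R]_d) : R :=
  inf [set sphere_dist x y | y in A].

Definition spherical_simplex (R : realType) (n : nat)
    (P : 'I_n.+1 -> 'rV[R]_n.+1) : Prop :=
  (forall i, unit_sphere (P i)) /\ free [seq P i | i : 'I_n.+1].

Definition edge_matrix (R : realType) (n : nat)
    (P : 'I_n.+1 -> 'rV[R]_n.+1) : 'M[R]_n.+1 :=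
  \matrix_(i, j) dotE (P i) (P j).

Definition outer_normal (R : realType) (n : nat)
    (P : 'I_n.+1 -> 'rV[R]_n.+1) (i : 'I_n.+1) : 'rV[R]_n.+1 :=
  let M := edge_matrix P in
  (Num.sqrt (cofactor M i i * \det M))^-1 *:
    - \sum_(j < n.+1) cofactor M i j *: P j.

(* Vertices are indexed from 0, so p_1, ..., p_(k+1) are the P i with i <= k,
   and the indices k+2, ..., n+1 are the i with k < i. *)
Definition face_span (R : realType) (n k : nat)
    (P : 'I_n.+1 -> 'rV[R]_n.+1) : {vspace 'rV[R]_n.+1} :=
  <<[seq P i | i in [pred j : 'I_n.+1 | (j <= k)%N]]>>%VS.

Definition face_plane (R : realType) (n k : nat)
    (P : 'I_n.+1 -> 'rV[R]_n.+1) : set 'rV[R]_n.+1 :=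
  [set x | x \in face_span k P] `&` @unit_sphere R n.+1.

(* The two minors below are meant for k <= n, where [inord] embeds the
   indices 0, ..., k of 'I_k.+1 into 'I_n.+1 without changing their value. *)
Definition leading_minor (R : realType) (n k : nat) (M : 'M[R]_n.+1) : R :=
  \det (\matrix_(a < k.+1, b < k.+1) M (inord a) (inord b)).

Definition bordered_index (n k : nat) (i : 'I_n.+1) (a : 'I_k.+2) : 'I_n.+1 :=
  if (a <= k)%N then inord a else i.

(* m_i^j: rows 0, ..., k, i and columns 0, ..., k, j. *)
Definition bordered_minor (R : realType) (n k : nat) (M : 'M[R]_n.+1)
    (i j : 'I_n.+1) : R :=
  \det (mxsub (@bordered_index n k i) (@bordered_index n k j) M).

(* Main.v *)
Require Import Defs.
From mathcomp Require Import all_boot all_order all_algebra.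
From mathcomp Require Import all_classical all_reals all_analysis.
From mathcomp Require Import ring lra.
Import Order.TTheory GRing.Theory Num.Theory.
Set Implicit Arguments.
Unset Strict Implicit.
Unset Printing Implicit Defensive.
Local Open Scope classical_set_scope.
Local Open Scope ring_scope.

(** Let [W] be the span of the vertices of the face, and split [p] as [u + v]
    with [u] in [W] and [v] orthogonal to [W].  A unit
    vector [q] of [W] satisfies [dotE p q = dotE u q], which by Cauchy-Schwarz
    is at most the length of [u], with equality at [q = u / |u|] (at every
    [q] when [u = 0]); as [acos] is decreasing, the distance is attained and
    its cosine is [|u|] ([cos_dist_to_subspace]).  Since [p] is a unit vector,
    [|u| ^ 2 = 1 - |v| ^ 2], and the double sum of the formula is [|v| ^ 2],
    for two reasons.

    The outer normals are rescaled dual vectors: if [c] is the coordinate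
    vector of [p] in the basis [P], then [dotE p (e i)] is [- c i] times
    [sqrt (\det M) / sqrt (cofactor M i i)] ([dotE_outer_normal]), so the
    square roots cancel against the coefficients of the sum and leave
    [c s * c t].

    The quotient of a bordered minor by the leading minor is a Schur
    complement of a Gram matrix, that is, the scalar product of the
    components of [P t] and [P s] orthogonal to [W] ([bordered_minorE]).
    These components vanish for the vertices of the face, so the sum over the
    remaining indices is the full expansion of [|v| ^ 2].

    Vectors are rows; the projection onto [W] is right multiplication by the
    symmetric idempotent [row_proj B], where the rows of [B] are the vertices
    of the face. *)

(** * The scalar product *)

Lemma dotE_mulmx (R : realType) (d : nat) (x y : 'rV[R]_d) :
  dotE x y = (x *m y^T) 0 0.
Proof. by rewrite !mxE; apply: eq_bigr => i _; rewrite mxE. Qed.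

Lemma dotE_mulmxl (R : realType) (d m : nat) (x : 'rV[R]_d) (C : 'M[R]_(d, m))
    (y : 'rV[R]_m) :
  dotE (x *m C) y = dotE x (y *m C^T).
Proof. by rewrite !dotE_mulmx trmx_mul trmxK mulmxA. Qed.

Lemma dotEC (R : realType) (d : nat) (x y : 'rV[R]_d) : dotE x y = dotE y x.
Proof. by apply: eq_bigr => i _; rewrite mulrC. Qed.

Lemma dotEBl (R : realType) (d : nat) (x y z : 'rV[R]_d) :
  dotE (x - y) z = dotE x z - dotE y z.
Proof. by rewrite -sumrB; apply: eq_bigr => i _; rewrite !mxE mulrBl. Qed.

Lemma dotEZl (R : realType) (d : nat) (a : R) (x y : 'rV[R]_d) :
  dotE (a *: x) y = a * dotE x y.
Proof. by rewrite mulr_sumr; apply: eq_bigr => i _; rewrite mxE mulrA. Qed.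

Lemma dotE_suml (R : realType) (d : nat) (I : finType) (c : I -> R)
    (x : I -> 'rV[R]_d) (y : 'rV[R]_d) :
  dotE (\sum_i c i *: x i) y = \sum_i c i * dotE (x i) y.
Proof.
rewrite dotE_mulmx mulmx_suml summxE; apply: eq_bigr => i _.
by rewrite -dotE_mulmx dotEZl.
Qed.

Lemma dotE_ge0 (R : realType) (d : nat) (x : 'rV[R]_d) : 0 <= dotE x x.
Proof. by apply: sumr_ge0 => i _; rewrite -expr2 sqr_ge0. Qed.

Lemma dotE_eq0 (R : realType) (d : nat) (x : 'rV[R]_d) :
  (dotE x x == 0) = (x == 0).
Proof.
apply/eqP/eqP => [x0|->]; last by rewrite /dotE big1 // => i _; rewrite mxE mul0r.
apply/rowP => i; rewrite mxE; apply/eqP; rewrite -sqrf_eq0 expr2; apply/eqP.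
by apply: (psumr_eq0P _ x0) => // j _; rewrite -expr2 sqr_ge0.
Qed.

(** Cauchy-Schwarz, from the nonnegativity of the squared length of the
    component of [u] orthogonal to [q]. *)
Lemma dotE_sqr_le (R : realType) (d : nat) (u q : 'rV[R]_d) :
  dotE q q = 1 -> dotE u q ^+ 2 <= dotE u u.
Proof.
move=> q1; have := dotE_ge0 (u - dotE u q *: q).
rewrite dotEBl dotEZl !(dotEC _ (u - _)) !dotEBl !dotEZl (dotEC q u) q1.
lra.
Qed.

(** * The distance to a great subsphere *)

Lemma acos_le (R : realType) (x y : R) :
  -1 <= x -> x <= y -> y <= 1 -> acos y <= acos x.
Proof.
move=> x1 xy y1.
have [/andP[ax0 axp] cx] : 0 <= acos x <= pi /\ cos (acos x) = x.
  by apply: acos_def; rewrite x1 (le_trans xy).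
have [/andP[ay0 ayp] cy] : 0 <= acos y <= pi /\ cos (acos y) = y.
  by apply: acos_def; rewrite y1 (le_trans x1).
rewrite leNgt; apply/negP => lxy.
have : cos (acos y) < cos (acos x) by rewrite ltr_cos// in_itv/= ?ax0 ?ay0.
by rewrite cx cy ltNge xy.
Qed.

(** The hypothesis on [u] says that it is the orthogonal projection of [p]
    on [V]. *)
Lemma cos_dist_to_subspace (R : realType) (d : nat) (V : {vspace 'rV[R]_d})
    (p u : 'rV[R]_d) (S := [set x | x \in V] `&` unit_sphere (d := d)) :
  dotE p p = 1 -> u \in V -> (forall q, q \in V -> dotE p q = dotE u q) ->
  (S !=set0)%classic ->
  (exists2 q, S q & sphere_dist p q = dist_to p S) /\
  cos (dist_to p S) = Num.sqrt (dotE u u).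
Proof.
move=> p1 uV pu [q0 [q0V q01]].
have u0 := dotE_ge0 u.
have u1 : Num.sqrt (dotE u u) <= 1.
  rewrite -sqrtr1 ler_wsqrtr //; have [->//|un0] := eqVneq (dotE u u) 0.
  have ugt0 : 0 < dotE u u by rewrite lt_def un0.
  have := dotE_sqr_le u p1; rewrite dotEC pu // expr2.
  by rewrite -ler_pdivlMr // divff.
have [q [qV q1] pq] : exists2 q, S q & dotE p q = Num.sqrt (dotE u u).
  (* When [p] is orthogonal to [V] all points of [S] are at distance [pi / 2]. *)
  have [u00|un0] := eqVneq (dotE u u) 0.
    exists q0 => //; rewrite u00 sqrtr0 pu //.
    move/eqP: u00; rewrite dotE_eq0 => /eqP ->.
    by rewrite /dotE big1 // => i _; rewrite mxE mul0r.
  have s0 : Num.sqrt (dotE u u) != 0.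
    by rewrite sqrtr_eq0 -ltNge lt_def un0.
  have us : dotE u u = Num.sqrt (dotE u u) ^+ 2 by rewrite sqr_sqrtr.
  exists ((Num.sqrt (dotE u u))^-1 *: u).
    split; first by rewrite /= memvZ.
    by rewrite /unit_sphere /= dotEZl dotEC dotEZl {3}us; field.
  by rewrite dotEC dotEZl dotEC pu // {2}us; field.
have qmin y : S y -> sphere_dist p q <= sphere_dist p y.
  move=> [yV y1]; rewrite /sphere_dist pq.
  have : `|dotE p y| <= Num.sqrt (dotE u u).
    by rewrite -sqrtr_sqr ler_wsqrtr // pu // dotE_sqr_le.
  rewrite ler_norml => /andP[h1 h2]; apply: acos_le => //.
  by apply: le_trans h1; rewrite lerN2.
have -> : dist_to p S = sphere_dist p q.
  apply/eqP; rewrite eq_le; apply/andP; split.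
    apply: ge_inf; last by exists q.
    by exists (sphere_dist p q) => _ [y Sy <-]; apply: qmin.
  apply: lb_le_inf; first by exists (sphere_dist p q), q.
  by move=> _ [y Sy <-]; apply: qmin.
split; first by exists q.
rewrite /sphere_dist pq acosK // in_itv /= u1 andbT.
by rewrite (le_trans _ (sqrtr_ge0 _)) // lerN10.
Qed.

(** * Orthogonal projection on the row space of a matrix *)

(** For [B] with independent rows this is the matrix of the orthogonal
    projection on the row space; [B *m B^T] is the Gram matrix of the rows. *)
Definition row_proj (R : realType) (m d : nat) (B : 'M[R]_(m, d)) : 'M[R]_d :=
  B^T *m invmx (B *m B^T) *m B.

(** If [v] is a row vector killed by the Gram matrix, the vector [v *m B] has length 0. *)
Lemma gram_unitmx (R : realType) (m d : nat) (B : 'M[R]_(m, d)) :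
  row_free B -> B *m B^T \in unitmx.
Proof.
move=> fB; rewrite -row_free_unit; apply: inj_row_free => v vG.
apply: (row_free_inj fB); rewrite mul0mx; apply/eqP.
by rewrite -dotE_eq0 dotE_mulmx trmx_mul mulmxA -(mulmxA v) vG mul0mx mxE.
Qed.

Lemma trmx_row_proj (R : realType) (m d : nat) (B : 'M[R]_(m, d)) :
  (row_proj B)^T = row_proj B.
Proof. by rewrite /row_proj !trmx_mul trmx_inv !trmx_mul !trmxK mulmxA. Qed.

Lemma mul_row_proj (R : realType) (m d : nat) (B : 'M[R]_(m, d)) :
  row_free B -> B *m row_proj B = B.
Proof. by move=> fB; rewrite /row_proj !mulmxA mulmxV ?gram_unitmx // mul1mx. Qed.

Lemma row_proj_idem (R : realType) (m d : nat) (B : 'M[R]_(m, d)) :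
  row_free B -> row_proj B *m row_proj B = row_proj B.
Proof. by move=> fB; rewrite {1}/row_proj -mulmxA mul_row_proj. Qed.

(** Schur complement: eliminating the block [x *m B^T] with the Gram matrix
    of [B] replaces the corner [x *m y^T] by the scalar product of [y] with
    the component of [x] orthogonal to the rows of [B]. *)
Lemma det_bordered_gram (R : realType) (m d : nat) (B : 'M[R]_(m, d))
    (x y : 'rV[R]_d) :
  row_free B ->
  \det (col_mx B x *m (col_mx B y)^T) =
  \det (B *m B^T) * dotE (x - x *m row_proj B) y.
Proof.
move=> fB; rewrite tr_col_mx mul_col_row.
have -> : block_mx (B *m B^T) (B *m y^T) (x *m B^T) (x *m y^T) =
    block_mx 1%:M 0 (x *m B^T *m invmx (B *m B^T)) 1%:M *m
    block_mx (B *m B^T) (B *m y^T) 0 ((x - x *m row_proj B) *m y^T).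
  rewrite mulmx_block !mul1mx !mul0mx !addr0.
  rewrite mulmxKV ?gram_unitmx // mulmxBl /row_proj !mulmxA.
  by rewrite addrC subrK.
by rewrite det_mulmx det_lblock det_ublock !det1 !mul1r det_mx11 -dotE_mulmx.
Qed.

(** * Coordinates and outer normals of a simplex *)

Definition vertex_mx (R : realType) (n : nat) (P : 'I_n.+1 -> 'rV[R]_n.+1) :
  'M[R]_n.+1 := \matrix_i P i.

Lemma edge_matrixE (R : realType) (n : nat) (P : 'I_n.+1 -> 'rV[R]_n.+1) :
  edge_matrix P = vertex_mx P *m (vertex_mx P)^T.
Proof.
by apply/matrixP => i j; rewrite !mxE; apply: eq_bigr => l _; rewrite !mxE.
Qed.

Lemma vertex_mx_unit (R : realType) (n : nat) (P : 'I_n.+1 -> 'rV[R]_n.+1) :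
  free [seq P i | i : 'I_n.+1] -> vertex_mx P \in unitmx.
Proof.
have -> : [seq P i | i : 'I_n.+1] = [tuple P i | i < n.+1] by [].
move=> /freeP fP; rewrite -row_free_unit; apply: inj_row_free => v vA.
apply/rowP => i; rewrite mxE; apply: (fP (v 0)).
rewrite -[RHS]vA mulmx_sum_row; apply: eq_bigr => j _.
by rewrite rowK -tnth_nth tnth_mktuple.
Qed.

(** The rows of [\adj M *m A] are, up to sign, the vectors that are
    normalized in the definition of the outer normals; they are [\det M] times
    the basis dual to the vertices. *)
Lemma adj_edge_matrix (R : realType) (n : nat) (P : 'I_n.+1 -> 'rV[R]_n.+1)
    (A := vertex_mx P) :
  A \in unitmx ->
  \adj (edge_matrix P) *m A = \det (edge_matrix P) *: (invmx A)^T.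
Proof.
move=> uA; have uAT : A^T \in unitmx by rewrite unitmx_tr.
rewrite -[LHS](mulmxK uAT) -(mulmxA (\adj _)) -edge_matrixE mul_adj_mx.
by rewrite mul_scalar_mx trmx_inv.
Qed.

(** The adjugate is the transpose of the cofactor matrix, and [M] is symmetric. *)
Lemma cofactor_edge_matrixE (R : realType) (n : nat)
    (P : 'I_n.+1 -> 'rV[R]_n.+1) (i j : 'I_n.+1) :
  cofactor (edge_matrix P) i j = \adj (edge_matrix P) i j.
Proof.
have -> : \adj (edge_matrix P) i j = (\adj (edge_matrix P))^T j i by rewrite [RHS]mxE.
by rewrite trmx_adj edge_matrixE trmx_mul trmxK mxE.
Qed.

Lemma det_edge_matrix_gt0 (R : realType) (n : nat)
    (P : 'I_n.+1 -> 'rV[R]_n.+1) :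
  vertex_mx P \in unitmx -> 0 < \det (edge_matrix P).
Proof.
by rewrite unitmxE unitfE edge_matrixE det_mulmx det_tr -expr2 exprn_even_gt0.
Qed.

(** The cofactor is [\det M] times the squared length of a vector of the dual
    basis. *)
Lemma cofactor_edge_matrix_gt0 (R : realType) (n : nat)
    (P : 'I_n.+1 -> 'rV[R]_n.+1) (i : 'I_n.+1) :
  vertex_mx P \in unitmx -> 0 < cofactor (edge_matrix P) i i.
Proof.
move=> uA; set A := vertex_mx P in uA *.
have -> : cofactor (edge_matrix P) i i =
    \det (edge_matrix P) * dotE (row i (invmx A)^T) (row i (invmx A)^T).
  rewrite cofactor_edge_matrixE -[\adj _](mulmxK uA) adj_edge_matrix //.
  rewrite -scalemxAl mxE; congr (_ * _).
  by rewrite mxE; apply: eq_bigr => j _; rewrite !mxE.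
rewrite mulr_gt0 ?det_edge_matrix_gt0 // lt_def dotE_ge0 andbT dotE_eq0.
apply/eqP => r0.
have : row i ((invmx A)^T *m A^T) = 0 by rewrite row_mul r0 mul0mx.
rewrite -trmx_mul mulmxV // trmx1 => /rowP/(_ i)/eqP.
by rewrite !mxE eqxx oner_eq0.
Qed.

(** [p *m invmx (vertex_mx P)] lists the coordinates of [p] in the basis
    formed by the vertices. *)
Lemma dotE_outer_normal (R : realType) (n : nat) (P : 'I_n.+1 -> 'rV[R]_n.+1)
    (p : 'rV[R]_n.+1) (i : 'I_n.+1) (M := edge_matrix P) :
  vertex_mx P \in unitmx ->
  dotE p (outer_normal P i) =
  - (\det M * (p *m invmx (vertex_mx P)) 0 i) /
    (Num.sqrt (cofactor M i i) * Num.sqrt (\det M)).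
Proof.
move=> uA; have M0 := det_edge_matrix_gt0 uA.
rewrite /outer_normal -/M sqrtrM ?(ltW (cofactor_edge_matrix_gt0 _ uA)) //.
have -> : \sum_(j < n.+1) cofactor M i j *: P j =
    \det M *: row i (invmx (vertex_mx P))^T.
  have -> : \det M *: row i (invmx (vertex_mx P))^T =
      row i (\adj M *m vertex_mx P).
    by rewrite adj_edge_matrix //; apply/rowP => j; rewrite !mxE.
  rewrite row_mul mulmx_sum_row.
  apply: eq_bigr => j _.
  by rewrite rowK [row i _ 0 j]mxE /M cofactor_edge_matrixE.
have -> : (p *m invmx (vertex_mx P)) 0 i = dotE (row i (invmx (vertex_mx P))^T) p.
  by rewrite dotEC mxE; apply: eq_bigr => j _; rewrite !mxE.
by rewrite dotEC dotEZl -scaleNr dotEZl mulrC !mulNr.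
Qed.

(** * The face plane and its bordered minors *)

Definition face_mx (R : realType) (n k : nat)
    (P : 'I_n.+1 -> 'rV[R]_n.+1) : 'M[R]_(k.+1, n.+1) :=
  \matrix_(a < k.+1) P (inord a).

Lemma face_mx_row (R : realType) (n k : nat) (P : 'I_n.+1 -> 'rV[R]_n.+1)
    (j : 'I_n.+1) :
  (j <= k)%N -> P j = row (inord j) (face_mx k P).
Proof. by move=> jk; rewrite rowK inordK // inord_val. Qed.

Lemma face_mx_free (R : realType) (n k : nat) (P : 'I_n.+1 -> 'rV[R]_n.+1) :
  (k <= n)%N -> vertex_mx P \in unitmx -> row_free (face_mx k P).
Proof.
move=> kn uA.
pose f (a : 'I_k.+1) : 'I_n.+1 := inord a.
have fE (a : 'I_k.+1) : f a = a :> nat.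
  by rewrite inordK // (leq_trans (ltn_ord a)).
(* [S] selects the first [k.+1] rows, and [S *m S^T = 1%:M]. *)
pose S : 'M[R]_(k.+1, n.+1) := rowsub f 1%:M.
have -> : face_mx k P = S *m vertex_mx P.
  apply/row_matrixP => a; rewrite row_mul rowK.
  have -> : row a S = delta_mx 0 (f a).
    by apply/rowP => j; rewrite !mxE eqxx eq_sym.
  by rewrite -rowE rowK.
rewrite /row_free mxrankMfree ?row_free_unit //; apply/row_freeP.
exists S^T; apply/matrixP => a b; rewrite !mxE (bigD1 (f a)) //= !mxE eqxx mul1r.
rewrite big1 ?addr0 => [|j ja]; last by rewrite !mxE eq_sym (negPf ja) mul0r.
have f_inj : injective f by move=> x y /(congr1 val); rewrite /= !fE => /val_inj.
by rewrite (inj_eq f_inj) eq_sym.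
Qed.

Lemma leading_minorE (R : realType) (n k : nat) (P : 'I_n.+1 -> 'rV[R]_n.+1) :
  leading_minor k (edge_matrix P) = \det (face_mx k P *m (face_mx k P)^T).
Proof.
congr (\det _); apply/matrixP => a b; rewrite !mxE.
by apply: eq_bigr => j _; rewrite !mxE.
Qed.

Lemma bordered_minorE (R : realType) (n k : nat) (P : 'I_n.+1 -> 'rV[R]_n.+1)
    (s t : 'I_n.+1) :
  row_free (face_mx k P) ->
  bordered_minor k (edge_matrix P) s t =
  leading_minor k (edge_matrix P) *
    dotE (P s - P s *m row_proj (face_mx k P)) (P t).
Proof.
move=> fB; rewrite leading_minorE -det_bordered_gram //.
have castdet (m1 m2 : nat) (e : m1 = m2) (X : 'M[R]_m1) :
  \det (castmx (e, e) X) = \det X by case: m2 / e; rewrite castmx_id.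
(* The border has the last index of ['I_k.+2], so the block decomposition
   lives over ['I_(k.+1 + 1)]. *)
rewrite -(castdet _ _ (addn1 k.+1)); congr (\det _).
have rowE i (a : 'I_k.+2) j :
    P (@bordered_index n k i a) 0 j =
    col_mx (face_mx k P) (P i) (cast_ord (esym (addn1 k.+1)) a) j.
  rewrite /bordered_index mxE; case: splitP => b /= ab.
    by rewrite ab -ltnS ltn_ord mxE.
  by rewrite ab ord1 addn0 ltnn.
apply/matrixP => a b; rewrite castmxE !mxE.
by apply: eq_bigr => j _; rewrite !rowE /= [in RHS](mxE _ _ j).
Qed.

Lemma face_spanP (R : realType) (n k : nat) (P : 'I_n.+1 -> 'rV[R]_n.+1)
    (q : 'rV[R]_n.+1) :
  (k <= n)%N -> row_free (face_mx k P) ->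
  (q \in face_span k P) = (q *m row_proj (face_mx k P) == q).
Proof.
move=> kn fB; set B := face_mx k P in fB *.
apply/idP/eqP => [|<-].
  (* Vectors fixed by the projection form a kernel, hence a subspace, and it
     contains the vertices of the face. *)
  pose f : {linear 'rV[R]_n.+1 -> 'rV[R]_n.+1} := mulmxr (row_proj B - 1%:M).
  suff /subvP sub : (face_span k P <= lker (linfun f))%VS.
    move=> /sub; rewrite memv_ker lfunE /= mulmxBr mulmx1 subr_eq0.
    by move/eqP.
  apply/span_subvP => _ /fintype.imageP[j jk ->].
  rewrite memv_ker lfunE /= mulmxBr mulmx1 subr_eq0.
  by rewrite (face_mx_row P jk) -row_mul mul_row_proj.
rewrite /row_proj mulmxA mulmx_sum_row; apply: memv_suml => a _.
rewrite memvZ // rowK memv_span //; apply: fintype.image_f.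
by rewrite inE inordK ?(leq_trans (ltn_ord a)) // -ltnS.
Qed.

Theorem theorem3p2 (R : realType) (n k : nat) (P : 'I_n.+1 -> 'rV[R]_n.+1)
    (p : 'rV[R]_n.+1) (hP : spherical_simplex P) (hk : (k < n)%N)
    (hp : unit_sphere p) :
  let M := edge_matrix P in
  let e := outer_normal P in
  let Ws := face_plane k P in
  (exists2 q, Ws q & sphere_dist p q = dist_to p Ws) /\
  cos (dist_to p Ws) =
    Num.sqrt (1 - \sum_(s < n.+1 | (k < s)%N) \sum_(t < n.+1 | (k < t)%N)
      (Num.sqrt (cofactor M s s * cofactor M t t) * bordered_minor k M t s
         * dotE p (e t) * dotE p (e s)) / (\det M * leading_minor k M)).
Proof.
move=> M e Ws; case: hP => P1 Pfree.
have uA := vertex_mx_unit Pfree; set A := vertex_mx P in uA.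
have kn := ltnW hk; have fB := face_mx_free kn uA.
set B := face_mx k P in fB; set Q := row_proj B.
have QP (j : 'I_n.+1) : (j <= k)%N -> P j *m Q = P j.
  by move=> jk; rewrite (face_mx_row P jk) -row_mul mul_row_proj.
have inW q : (q \in face_span k P) = (q *m Q == q) by apply: face_spanP.
have pQW : p *m Q \in face_span k P by rewrite inW -mulmxA row_proj_idem.
have pQ q : q \in face_span k P -> dotE p q = dotE (p *m Q) q.
  by rewrite inW dotE_mulmxl trmx_row_proj => /eqP ->.
have Wn0 : (Ws !=set0)%classic.
  by exists (P ord0); split; [rewrite /= inW QP | apply: P1].
have [att ->] := cos_dist_to_subspace hp pQW pQ Wn0.
split=> //; congr (Num.sqrt _).
pose c := p *m invmx A.
have pc : p = \sum_i c 0 i *: P i.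
  rewrite -{1}(mulmxKV uA p) mulmx_sum_row.
  by apply: eq_bigr => i _; rewrite rowK.
(* The scalar product of the components of [P t] and [P s] orthogonal to the
   face: one of the two components may be left unprojected. *)
pose g (s t : 'I_n.+1) := dotE (P t - P t *m Q) (P s).
have g0 (s t : 'I_n.+1) : ~~ ((k < s) && (k < t))%N -> g s t = 0.
  rewrite /g negb_and -!leqNgt => /orP[sk|tk].
    by rewrite dotEBl dotE_mulmxl trmx_row_proj QP // subrr.
  by rewrite QP // subrr; apply/eqP; rewrite dotEC dotE_mulmx trmx0 mulmx0 mxE.
have termE s t : (Num.sqrt (cofactor M s s * cofactor M t t) *
    bordered_minor k M t s * dotE p (e t) * dotE p (e s)) /
    (\det M * leading_minor k M) = c 0 s * (c 0 t * g s t).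
  have Mgt0 := det_edge_matrix_gt0 uA; rewrite -/M in Mgt0.
  have cs := cofactor_edge_matrix_gt0 s uA; rewrite -/M in cs.
  have ct := cofactor_edge_matrix_gt0 t uA; rewrite -/M in ct.
  have m0 : leading_minor k M != 0.
    by rewrite leading_minorE -unitfE -unitmxE gram_unitmx.
  rewrite bordered_minorE // -/(g s t) !dotE_outer_normal // -/M -/A -/c.
  rewrite sqrtrM ?ltW // -/(leading_minor k M).
  have dM : \det M = Num.sqrt (\det M) ^+ 2 by rewrite sqr_sqrtr ?ltW.
  have ds : Num.sqrt (cofactor M s s) != 0 by rewrite sqrtr_eq0 -ltNge.
  have dt : Num.sqrt (cofactor M t t) != 0 by rewrite sqrtr_eq0 -ltNge.
  have dM0 : Num.sqrt (\det M) != 0 by rewrite sqrtr_eq0 -ltNge.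
  set a := Num.sqrt (\det M) in dM dM0 *.
  by rewrite dM; field; rewrite m0 ds dt dM0.
under eq_bigr => s _ do under eq_bigr => t _ do rewrite termE.
have pQE : p - p *m Q = \sum_t c 0 t *: (P t - P t *m Q).
  rewrite {1 2}pc mulmx_suml -sumrB; apply: eq_bigr => t _.
  by rewrite -scalemxAl scalerBr.
have -> : \sum_(s < n.+1 | (k < s)%N) \sum_(t < n.+1 | (k < t)%N)
    c 0 s * (c 0 t * g s t) = dotE (p - p *m Q) p.
  rewrite {3}pc dotEC dotE_suml big_mkcond; apply: eq_bigr => s _.
  rewrite dotEC pQE dotE_suml -mulr_sumr big_mkcond.
  case: ifP => ks; last first.
    rewrite big1 ?mulr0 // => t _; rewrite -/(g s t) g0 ?mulr0 //.
    by rewrite ks.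
  congr (_ * _); apply: eq_bigr => t _.
  by case: ifP => // kt; rewrite -/(g s t) g0 ?mulr0 // kt andbF.
have pp : dotE p p = 1 by [].
rewrite dotEBl pp opprB addrC subrK.
by rewrite [LHS]dotE_mulmxl trmx_row_proj -mulmxA row_proj_idem // dotEC.
Qed.
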